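(* For every integer $n\geq 2$, the number of spanning quasi-trees of the bouquet $\mathbb{F}'^{1}_n$ is $\kappa(\mathbb{F}'^{1}_n)=f_n+\ell_{n-1}$.
   Context: A bouquet is a ribbon graph (surface with boundary made of vertex discs and edge ribbons) with exactly one vertex. A quasi-tree is a ribbon graph with exactly one boundary component; $\kappa(G)$ is the number of $F\subseteq E(G)$ such that the spanning ribbon subgraph $(V(G),F)$ (delete edges outside $F$) is a quasi-tree. A bouquet with edges $1,\dots,n$ is given by a signed rotation: a cyclic sequence in which each label occurs twice, recording the order in which the edge ends meet the vertex boundary; occurrences may carry a minus sign (plus omitted), and edge $i$ is an orientable loop iff its two occurrences have the same sign, a non-orientable loop (forming a Möbius band with the vertex) otherwise. $\mathbb{F}'^{1}_2$ has signed rotation $(-1,2,2,1)$; for $n\geq3$, $\mathbb{F}'^{1}_n$ has signed rotation $-1,2,3,2,1$, followed by $i,i-1$ for $i=4,\dots,n$, followed by $n$, i.e. $(-1,2,3,2,1,4,3,5,4,\dots,n,n-1,n)$; it is obtained from the bouquet $\mathbb{F}'_n$ (same rotation without the minus sign) by adding a half-twist to edge $1$. Fibonacci numbers: $f_1=f_2=1$, $f_k=f_{k-1}+f_{k-2}$; Lucas numbers: $\ell_1=1,\ell_2=3$, $\ell_k=\ell_{k-1}+\ell_{k-2}$. *)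

(* Defs.v *)
From mathcomp Require Import all_boot all_order all_algebra finmap.
From mathcomp Require Import zify.

Set Implicit Arguments.
Unset Strict Implicit.
Unset Printing Implicit Defensive.

(* A letter of a signed rotation is a nonzero integer: its absolute value is
   the edge label, its sign the sign of the occurrence. *)
Definition is_signed_rotation (w : seq int) : bool :=
  (0%R \notin w) && all (fun x => count_mem (absz x) (map absz w) == 2) w.

(* A bouquet, with its vertex disc oriented and a base point chosen on the
   boundary of that disc, so that the cyclic rotation is read as a sequence. *)
Record bouquet := Bouquet {
  rotation : seq int;
  rotationP : is_signed_rotation rotation }.

Definition edges (B : bouquet) : {fset nat} :=
  [fset l in map absz (rotation B)]%fset.

Definition sub_rotation (F : {fset nat}) (w : seq int) : seq int :=
  [seq x <- w | absz x \in F].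

Lemma sub_rotationP (F : {fset nat}) (w : seq int) :
  is_signed_rotation w -> is_signed_rotation (sub_rotation F w).
Proof.
case/andP=> w0 /allP w2; rewrite /is_signed_rotation mem_filter negb_and w0 orbT.
apply/allP=> x; rewrite mem_filter => /andP[xF /w2 /eqP<-]; apply/eqP.
rewrite !count_map count_filter; apply: eq_count => y /=.
by case: eqP => // ->; rewrite xF.
Qed.

(* The spanning ribbon subgraph (V(B), F). *)
Definition spanning_sub (B : bouquet) (F : {fset nat}) : bouquet :=
  Bouquet (sub_rotationP F (rotationP B)).

(* The ribbon end at position j of the rotation meets the boundary circle of
   the vertex disc in a segment; (j, false) is its first endpoint and (j, true)
   its last one, in the direction in which the rotation is read.  The boundary
   of the surface consists of the arcs of the vertex circle between consecutive
   ribbon ends and of the two free sides of each ribbon, glued at these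
   points. *)
Definition corner (w : seq int) : finType := ('I_(size w) * bool)%type.

Definition vertex_arc (w : seq int) (p q : corner w) : bool :=
  [&& p.2, ~~ q.2 & q.1 == ordS p.1].

(* An untwisted ribbon joins the first endpoint of one of its ends to the last
   endpoint of the other; a half-twisted ribbon joins first to first and last
   to last. *)
Definition ribbon_side (w : seq int) (p q : corner w) : bool :=
  let x := nth 0%R w p.1 in let y := nth 0%R w q.1 in
  [&& p.1 != q.1, absz x == absz y &
      if (x < 0)%R == (y < 0)%R then p.2 != q.2 else p.2 == q.2].

Definition boundary_adj (w : seq int) (p q : corner w) : bool :=
  [|| @vertex_arc w p q, @vertex_arc w q p | @ribbon_side w p q].

(* With no edges the surface is the vertex disc, whose single boundary
   component contains no corner. *)
Definition boundary_components (B : bouquet) : nat :=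
  if rotation B is [::] then 1 else n_comp (@boundary_adj (rotation B)) predT.

Definition quasi_tree (B : bouquet) : bool := boundary_components B == 1.

Definition kappa (B : bouquet) : nat :=
  #|` [fset F in fpowerset (edges B) | quasi_tree (spanning_sub B F)]%fset |.

(* The values for n < 2 are irrelevant. *)
Definition twisted_fib_rotation (n : nat) : seq int :=
  if n <= 2 then (-1)%Z :: map Posz [:: 2; 2; 1]
  else (-1)%Z :: map Posz ([:: 2; 3; 2; 1] ++
         flatten [seq [:: i; i.-1] | i <- iota 4 (n - 3)] ++ [:: n]).

Lemma twisted_fib_rotationP (n : nat) :
  is_signed_rotation (twisted_fib_rotation n).
Proof.
rewrite /twisted_fib_rotation; case: leqP => // n3; apply/andP.
set s := (X in map Posz X).
have cw m k : count_mem k (flatten [seq [:: i; i.-1] | i <- iota m.+1 (n - 3)])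
    = (m < k <= m + (n - 3)) + (m <= k < m + (n - 3)).
  elim: (n - 3) m => [|d IH] m /=; first by lia.
  by rewrite IH; lia.
have cs k : count_mem k (1 :: s) = (0 < k <= n).*2.
  by rewrite /= count_cat cw /=; lia.
have lE : map absz ((-1)%Z :: map Posz s) = 1 :: s.
  by rewrite map_cons mapK.
have sP k : k \in 1 :: s -> 0 < k <= n.
  by rewrite -has_pred1 has_count cs; case: (_ && _).
split.
  by apply/negP => /(map_f absz); rewrite lE => /sP.
by apply/allP=> x /(map_f absz); rewrite lE cs => /sP ->.
Qed.

Definition twisted_fib_bouquet (n : nat) : bouquet :=
  Bouquet (twisted_fib_rotationP n).

Fixpoint fibonacci (k : nat) : nat :=
  match k with
  | 0 => 0
  | 1 => 1
  | (k'.+1 as k1).+1 => fibonacci k1 + fibonacci k'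
  end.

Fixpoint lucas (k : nat) : nat :=
  match k with
  | 0 => 2
  | 1 => 1
  | (k'.+1 as k1).+1 => lucas k1 + lucas k'
  end.

(* Main.v *)
Require Import Defs.
From mathcomp Require Import all_boot.
From mathcomp Require Import all_order all_algebra finmap zify.

Set Implicit Arguments.
Unset Strict Implicit.
Unset Printing Implicit Defensive.

(** A surface has one boundary component iff every two-colouring of its corners
    that is constant along arcs and ribbon sides is constant.  With this
    criterion, two adjacent ends of an untwisted loop close up a boundary
    component of their own, while in [A m B n m n] the loops [m] and [n] can be
    erased, since following the boundary through them joins the end of [A] to
    the start of [B] and the end of [B] to the start of [A].  Splitting the
    spanning subgraphs of the bouquet with [n + 2] edges according to whether
    they contain the edges [n + 2] and [n + 1] then gives
    [kappa (n + 2) = kappa (n + 1) + kappa n], the recurrence of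
    [f_n + l_(n-1)]. *)

(** * Boundary components and two-colourings of corners *)

(* [f i s] is the colour of the corner [(i, s)]. *)
Definition boundary_colouring (w : seq int) (f : nat -> bool -> bool) : Prop :=
  [/\ forall i, i.+1 < size w -> f i true = f i.+1 false,
      forall i, i.+1 = size w -> f i true = f 0 false
    & forall i j s, i < size w -> j < size w -> i != j ->
        absz (nth 0%R w i) = absz (nth 0%R w j) ->
        f i s = f j (s (+) ((nth 0%R w i < 0)%R == (nth 0%R w j < 0)%R))].

(** The bounds on [i] and [j] make this vacuous for the empty word, in accordance with the single
    boundary circle of the bare vertex disc. *)
Definition connected_boundary (w : seq int) : Prop :=
  forall f, boundary_colouring w f ->
  forall i j s t, i < size w -> j < size w -> f i s = f j t.

Lemma boundary_adj_sym (w : seq int) : symmetric (@boundary_adj w).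
Proof.
move=> p q; rewrite /boundary_adj orbCA; congr (_ || (_ || _)).
rewrite /ribbon_side eq_sym [absz _ == _]eq_sym [(_ < 0)%R == _]eq_sym.
by rewrite [p.2 == _]eq_sym.
Qed.

(** The two arc clauses of a colouring split [ordS] into the ordinary successor and the wrap-around
    at the last position. The exclusive or in the ribbon clause swaps first and last endpoint
    exactly when the signs agree, that is, for an untwisted ribbon. *)
Lemma boundary_colouringP (w : seq int) (f : nat -> bool -> bool) :
  boundary_colouring w f <->
  forall p q : corner w, boundary_adj p q -> f p.1 p.2 = f q.1 q.2.
Proof.
split=> [[arc wrap rib]|adjf].
  have arcf (p q : corner w) : vertex_arc p q -> f p.1 p.2 = f q.1 q.2.
    case: p q => [i s] [j t] /and3P[/= -> /negbTE-> /eqP->] /=.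
    have := ltn_ord i; rewrite leq_eqVlt => /orP[/eqP iE|iw].
      by rewrite (wrap _ iE) iE modnn.
    by rewrite modn_small // arc.
  move=> p q /or3P[/arcf//|/arcf//|].
  case: p q => [i s] [j t] /and3P[/= ij /eqP eij st].
  rewrite (rib i j) //; congr (f _ _).
  by move: st; case: ifP => _; case: s t => [] [].
have arc (i j : 'I_(size w)) : j = ordS i -> f i true = f j false.
  by move=> ->; apply: (adjf (i, true) (ordS i, false)); rewrite /boundary_adj
     /vertex_arc /= eqxx.
split=> [i iw|i iw|i j s iw jw ij eij].
- apply: (arc (Ordinal (ltnW iw)) (Ordinal iw)).
  by apply/val_inj; rewrite /= modn_small.
- have iw' : i < size w by rewrite -iw.
  have w0 : 0 < size w by rewrite -iw.
  apply: (arc (Ordinal iw') (Ordinal w0)).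
  by apply/val_inj; rewrite /= iw modnn.
- apply: (adjf (Ordinal iw, s) (Ordinal jw, _)).
  rewrite /boundary_adj; apply/or3P/Or33/and3P; split=> //=; first exact/eqP.
  by case: (_ == _); case: s.
Qed.

(** Each class has one root, so a single class forces every [root e y] to be [root e x]. Conversely,
    if everything is reachable from [x], then [predT] is the class of [x]. *)
Lemma n_comp1P (T : finType) (e : rel T) (x : T) : connect_sym e ->
  reflect (forall y, connect e x y) (n_comp e predT == 1).
Proof.
move=> sym_e; apply: (iffP eqP) => [n1 y|cx]; last first.
  by rewrite -(n_comp_connect sym_e x); apply: eq_n_comp_r => y; rewrite !inE cx.
have rT z : fingraph.root e z \in [predI roots e & predT] by rewrite !inE roots_root.
have /card_le1P le1 : #|[predI roots e & predT]| <= 1.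
  by rewrite -[#|_|]/(n_comp e predT) n1.
rewrite -root_connect //; have := le1 _ (rT x) (fingraph.root e y).
by rewrite rT inE => /esym; rewrite eq_sym.
Qed.

Lemma quasi_treeP (B : bouquet) :
  quasi_tree B <-> connected_boundary (rotation B).
Proof.
rewrite /quasi_tree /boundary_components; case: (rotation B) => [|a w'].
  by split.
set w := a :: w'; have sym_e : connect_sym (@boundary_adj w).
  exact: sym_connect_sym (@boundary_adj_sym w).
split=> [/(n_comp1P (ord0, false) sym_e) cw f /boundary_colouringP fP|cw].
  have f0 (p : corner w) : f p.1 p.2 = f 0 false.
    have /connectP[q + ->] := cw p; rewrite -[0]/(nat_of_ord (@ord0 (size w'))).
    pose p0 : corner w := (ord0, false).
    rewrite -/p0 -[f (ord0 : 'I__) false]/(f p0.1 p0.2).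
    by elim: q p0 => //= q1 q IH p0 /andP[/fP-> /IH].
  move=> i j s t iw jw.
  by rewrite (f0 (Ordinal iw, s)) (f0 (Ordinal jw, t)).
apply/(n_comp1P (ord0, false) sym_e) => -[i s].
(* The colour records reachability from the corner [(0, false)]. Being constant, this colouring puts
   every corner in that component; [false] beyond the end of the word is only a default. *)
pose f i s := if insub i is Some k then
  connect (@boundary_adj w) (ord0, false) (k, s) else false.
have fE (p : corner w) : f p.1 p.2 = connect (@boundary_adj w) (ord0, false) p.
  by rewrite /f valK -surjective_pairing.
rewrite -fE -(cw f _ 0 i false s) //.
  by rewrite -[0]/(nat_of_ord (@ord0 (size w'))) (fE (ord0, false)).
apply/boundary_colouringP => p q pq; rewrite !fE.
exact/(same_connect_r sym_e)/connect1.
Qed.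

(** * Trivial loops and interlaced pairs of loops *)

Lemma mem_nth_absz (w : seq int) i :
  i < size w -> absz (nth 0%R w i) \in map absz w.
Proof. by move=> iw; apply/map_f/mem_nth. Qed.

Lemma trivial_loop_disconnected (x y : int) (A C : seq int) :
  absz x = absz y -> (x < 0)%R = (y < 0)%R -> absz x \notin map absz (A ++ C) ->
  ~ connected_boundary (A ++ x :: y :: C).
Proof.
move=> axy sxy; rewrite map_cat mem_cat negb_or => /andP[xA xC].
set w := A ++ _; pose a := size A.
have wE i : nth 0%R w i = if i < a then nth 0%R A i else if i == a then x else
    if i == a.+1 then y else nth 0%R C (i - a.+2).
  rewrite /w nth_cat -/a; case: ltnP => // ai.
  have -> : (i == a) = (i - a == 0) by lia.
  have -> : (i == a.+1) = (i - a == 1) by lia.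
  have -> : i - a.+2 = (i - a).-2 by lia.
  by case: (i - a) => [|[|k]].
have sw : size w = (a + size C).+2 by rewrite /w size_cat /= -/a; lia.
have nw i : i < size w -> i != a -> i != a.+1 -> absz (nth 0%R w i) != absz x.
  rewrite sw wE => iw /negbTE ia /negbTE ia1; rewrite ia ia1; apply/eqP => E.
  move: E; case: ltnP => [ia'|ai] E.
    by case/negP: xA; rewrite -E mem_nth_absz.
  by case/negP: xC; rewrite -E mem_nth_absz //; lia.
(* The coloured corners are the last one of [x] and the first one of [y]. The arc between the ends
   and one side of the untwisted ribbon both join these two, so they form a component without
   [(a, false)]. *)
pose f i (s : bool) := if s then i == a else i == a.+1.
move=> /(_ f) cw; suff /cw/(_ a a true false): boundary_colouring w f.
  by rewrite /f eqxx; move=> H; have := H ltac:(lia) ltac:(lia); lia.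
split=> [i _|i|i j s iw jw ij]; rewrite /f ?eqSS //; first by rewrite sw; lia.
have wa : nth 0%R w a = x by rewrite wE ltnn eqxx.
have wa1 : nth 0%R w a.+1 = y by rewrite wE ltnNge leqnSn ifN ?eqxx //; lia.
move=> E; have [iE|iN] := boolP ((i == a) || (i == a.+1)); last first.
  have [jE|jN] := boolP ((j == a) || (j == a.+1)).
    have /eqP[] : absz (nth 0%R w i) != absz x by apply: nw; lia.
    by rewrite E; case/orP: jE => /eqP->; rewrite ?wa ?wa1.
  by case: s; case: (_ (+) _); lia.
have jE : (j == a) || (j == a.+1).
  rewrite -[_ || _]negbK negb_or; apply/negP => /andP[ja ja1].
  have /eqP[] := nw j jw ja ja1.
  by rewrite -E; case/orP: iE => /eqP->; rewrite ?wa ?wa1.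
have -> : (nth 0%R w i < 0)%R == (nth 0%R w j < 0)%R.
  by case/orP: iE jE => /eqP-> /orP[]/eqP->; rewrite ?wa ?wa1 ?sxy.
by rewrite addbT; case: s => /=; lia.
Qed.

(* Equations between colours are opaque to [lia] but make it branch on every
   boolean; only the comparisons of positions matter. *)
Ltac nat_lia :=
  repeat match goal with H : @eq bool _ _ |- _ => clear H end; lia.

(** With [a] and [b] the sizes of [A] and [B], the boundary leaving [A] visits [(a, false)],
    [(a+b+2, true)], [(a+b+3, false)], [(a+b+1, true)], [(a+b+2, false)], [(a, true)] and enters
    [B]; leaving [B], it visits [(a+b+1, false)], [(a+b+3, true)] and returns to the start of the
    word. These are all eight new corners, so no component is created or lost. *)
Lemma interlaced_pair_reduction (m n : int) (A B : seq int) :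
  absz m != absz n -> absz m \notin map absz (A ++ B) ->
  absz n \notin map absz (A ++ B) ->
  connected_boundary (A ++ m :: B ++ [:: n; m; n]) <-> connected_boundary (A ++ B).
Proof.
move=> mn mAB nAB; set w := A ++ m :: _; set w' := A ++ B.
(* [h] sends a position of [w'] to its place in [w]: only the first [m] has to be skipped, since the
   other three new ends come last. *)
pose a := size A; pose b := size B; pose h k := if k < a then k else k.+1.
have sw : size w = a + b + 4 by rewrite /w size_cat /= size_cat /= -/a -/b; lia.
have sw' : size w' = a + b by rewrite size_cat.
have wh k : k < a + b -> nth 0%R w (h k) = nth 0%R w' k.
  move=> kab; rewrite /w' /w /h [RHS]nth_cat -/a; case: ltnP => ka.
    by rewrite nth_cat ka.
  by rewrite nth_cat -/a ltnNge (leqW ka) /= subSn //= nth_cat -/b ifT //; lia.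
have wm1 : nth 0%R w a = m by rewrite /w nth_cat ltnn subnn.
have wr i : nth 0%R w (a + b + i.+1) = nth 0%R [:: n; m; n] i.
  rewrite /w nth_cat -/a ifN; last lia.
  have -> : a + b + i.+1 - a = (b + i).+1 by lia.
  by rewrite /= nth_cat -/b ifN ?addKn //; lia.
have wn1 := wr 0; have wm2 := wr 1; have wn2 := wr 2; rewrite /= in wn1 wm2 wn2.
have w'm k : k < a + b -> absz (nth 0%R w' k) != absz m.
  by move=> ka; apply: contraNneq mAB => <-; rewrite mem_nth_absz ?sw'.
have w'n k : k < a + b -> absz (nth 0%R w' k) != absz n.
  by move=> ka; apply: contraNneq nAB => <-; rewrite mem_nth_absz ?sw'.
have cover i : i < size w -> [\/ exists2 k, k < a + b & i = h k,
    i = a \/ i = a + b + 2 | i = a + b + 1 \/ i = a + b + 3].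
  rewrite sw => iw; case: (ltngtP i a) => ia; last by apply: Or32; left.
    by apply: Or31; exists i; rewrite /h; [lia | rewrite ia].
  case: (leqP i (a + b)) => iab.
    by apply: Or31; exists i.-1; rewrite /h; [|case: ltnP]; lia.
  have [->|H2] := eqVneq i (a + b + 2); first by apply: Or32; right.
  by apply: Or33; lia.
have hlt k : k < a + b -> h k < size w by rewrite /h; case: ifP; lia.
split=> [cw g [arc wrap rib]|cw' f [arc wrap rib]].
(* A colouring [g] of [w'] is extended to [w]: [v] is the colour of the path from the end of [A] to
   the start of [B], and [u] that of the path from the end of [B] back to position [0]. If [B] is
   empty, position [a] is outside [w'] and the end of [A] wraps to [0], hence [v = u]. *)
- pose u := g 0 false; pose v := if b == 0 then u else g a false.
  pose f i s := if i < a then g i s else if i == a then v else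
    if i <= a + b then g i.-1 s else
    if i == a + b + 1 then if s then v else u else
    if i == a + b + 2 then v else if s then u else v.
  have fh k s : k < a + b -> f (h k) s = g k s.
    rewrite /f /h => kab; case: (ltnP k a) => ka; first by rewrite ka.
    by repeat (case: ifPn => ? //; try lia).
  suff fP : boundary_colouring w f.
    move=> i j s t; rewrite sw' => iw jw.
    by rewrite -(fh i) // -(fh j) //; apply: (cw f fP); rewrite hlt.
  have fA i s : i < a -> f i s = g i s by rewrite /f => ->.
  have fa s : f a s = v by rewrite /f ltnn eqxx.
  have fB i s : a < i <= a + b -> f i s = g i.-1 s.
    by rewrite /f => ?; repeat (case: ifPn => ? //; try lia).
  have f1 s : f (a + b + 1) s = if s then v else u.
    by rewrite /f; repeat (case: ifPn => ? //; try lia).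
  have f2 s : f (a + b + 2) s = v by rewrite /f; repeat (case: ifPn => ? //; try lia).
  have f3 s : f (a + b + 3) s = if s then u else v by rewrite /f; repeat (case: ifPn => ? //; try lia).
  split=> [i|i|i j s iw jw ij].
  + rewrite sw => iw; have [ia|ia] := ltnP i a.
      rewrite (fA i) //; have [ia1|ia1] := ltnP i.+1 a.
        by rewrite fA // arc // sw'; lia.
      have iE : i.+1 = a by lia.
      rewrite iE fa /v; case: eqP => b0; first by rewrite wrap // sw'; lia.
      by rewrite arc ?iE // sw'; lia.
    have [->|ia1] := eqVneq i a.
      rewrite fa; have [b0|b0] := eqVneq b 0; last first.
        by rewrite fB ?(ltnn, leqnn) /v ?(negbTE b0) //; lia.
      by have -> : a.+1 = a + b + 1; rewrite ?f1 /v ?b0 //; lia.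
    have [iab|iab] := leqP i (a + b).
      rewrite fB; last lia.
      have [->|iab1] := eqVneq i (a + b).
        by rewrite -addn1 f1 wrap // sw'; lia.
      rewrite fB; last lia.
      by rewrite arc ?sw'; [congr g|]; lia.
    have [->|i1] := eqVneq i (a + b + 1); first by rewrite f1 -addnS f2.
    have -> : i = a + b + 2 by lia.
    by rewrite f2 -addnS f3.
  + rewrite sw => iE; have -> : i = a + b + 3 by lia.
    rewrite f3; have [a0|a0] := ltnP 0 a; first by rewrite fA.
    have a00 : a = 0 by lia.
    by have := fa false; rewrite a00 => ->; rewrite /v /u a00; case: ifP.
  + case: (cover i iw) ij => [[k kab ->]|iE|iE]; case: (cover j jw) => [[l lab ->]|jE|jE] ij.
    * rewrite !wh // !fh // => E; apply: rib; rewrite ?sw' //.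
      by apply: contraNneq ij => ->.
    * rewrite wh // => E; have := w'm k kab; rewrite E.
      by case: jE => ->; rewrite ?wm1 ?wm2 eqxx.
    * rewrite wh // => E; have := w'n k kab; rewrite E.
      by case: jE => ->; rewrite ?wn1 ?wn2 eqxx.
    * rewrite wh // => E; have := w'm l lab; rewrite -E.
      by case: iE => ->; rewrite ?wm1 ?wm2 eqxx.
    * by move=> _; case: iE jE ij => -> [] ->; rewrite ?fa ?f2.
    * by move/eqP; case: iE jE => -> [] ->; rewrite ?wm1 ?wm2 ?wn1 ?wn2 (negbTE mn).
    * rewrite wh // => E; have := w'n l lab; rewrite -E.
      by case: iE => ->; rewrite ?wn1 ?wn2 eqxx.
    * by move/eqP; case: iE jE => -> [] ->; rewrite ?wm1 ?wm2 ?wn1 ?wn2 eq_sym (negbTE mn).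
    * move=> _; case: iE jE ij => -> [] ->; rewrite ?eqxx // ?f1 ?f3 ?wn1 ?wn2 eqxx;
      by case: s.
(* Conversely, a colouring [f] of [w] is pulled back along [h]. The equations that follow are the
   single gluings along the two paths; [congruence] chains them. *)
- have rm s : f a s = f (a + b + 2) (~~ s).
    by rewrite (rib a (a + b + 2)) ?sw ?wm1 ?wm2 ?eqxx ?addbT //; nat_lia.
  have rn s : f (a + b + 1) s = f (a + b + 3) (~~ s).
    by rewrite (rib (a + b + 1) (a + b + 3)) ?sw ?wn1 ?wn2 ?eqxx ?addbT //; nat_lia.
  have e1 : f (a + b + 1) true = f (a + b + 2) false.
    by rewrite arc ?sw -?addnS //; nat_lia.
  have e2 : f (a + b + 2) true = f (a + b + 3) false.
    by rewrite arc ?sw -?addnS //; nat_lia.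
  have e3 : f (a + b + 3) true = f 0 false by rewrite wrap // sw; nat_lia.
  have e4 : f a true = f a.+1 false by rewrite arc ?sw //; nat_lia.
  have e5 : f (a + b) true = f (a + b + 1) false.
    by rewrite arc ?sw ?addn1 //; nat_lia.
  have e6 k : k.+1 = a -> f k true = f a false.
    by move=> kE; rewrite arc ?kE // sw; nat_lia.
  have rmt := rm true; have rmf := rm false; have rnt := rn true; have rnf := rn false.
  rewrite /= in rmt rmf rnt rnf.
  have gP : boundary_colouring w' (fun k => f (h k)).
    split=> [k|k|k l s]; rewrite sw'.
    + move=> kab; rewrite /h; have [ka|ka] := ltnP k a; last first.
        by rewrite ifN ?arc ?sw //; nat_lia.
      case: ltnP => ka1; first by rewrite arc // sw; nat_lia.
      have kE : k.+1 = a by nat_lia.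
      by rewrite e6 // kE; congruence.
    + move=> kE; rewrite /h; have [ka|ka] := ltnP k a.
        have b0 : b = 0 by nat_lia.
        rewrite ifT; last nat_lia.
        rewrite e6; last nat_lia.
        by rewrite b0 addn0 addn1 in e1 e2 e3 e5 rmt rmf rnt rnf; congruence.
      rewrite kE; case: ltnP => a0; first by congruence.
      have a00 : a = 0 by nat_lia.
      by rewrite a00 in e4 e5 e1 e2 rmt rmf rnt rnf *; congruence.
    + move=> kab lab kl E; rewrite -!wh // in E *; apply: rib; rewrite ?hlt //.
      by apply: contraNneq kl; rewrite /h; do 2!case: ltnP => ?; nat_lia.
  (* The reference corner [(a, false)] is tied to the last corner of [A] when [B] is empty, and
     otherwise, through the path, to the first corner of [B]. *)
  have c0 k s : k < a + b -> f (h k) s = f a false.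
    move=> kab; have [b0|b0] := posnP b.
      have ea : a.-1.+1 = a by nat_lia.
      rewrite -(e6 _ ea) -[X in _ = f X _]/(a.-1).
      have -> : a.-1 = h a.-1 by rewrite /h ifT //; nat_lia.
      by apply: (cw' _ gP); rewrite sw'; nat_lia.
    have -> : f a false = f (h a) false by rewrite /h ltnn; congruence.
    by apply: (cw' _ gP); rewrite sw'; nat_lia.
  have cu : f 0 false = f a false.
    have [a0|a0] := posnP a; last by rewrite -(c0 0 false) /h ?a0 //; nat_lia.
    by rewrite a0.
  suff cA i s : i < size w -> f i s = f a false.
    by move=> i j s t iw jw; rewrite (cA i) // (cA j).
  by move/cover=> [[k kab ->]|[]->|[]->]; first exact: c0; case: s; congruence.
Qed.

(** * Counting subsets by whether they contain a given element *)

Local Open Scope fset_scope.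
Local Open Scope nat_scope.

(** Removing [x] is a bijection from the subsets containing [x] to the subsets of [D]. *)
Lemma card_fpowersetU1 (K : choiceType) (x : K) (D : {fset K})
    (P : pred {fset K}) : x \notin D ->
  #|` [fset F in fpowerset (x |` D) | P F]| =
  #|` [fset F in fpowerset D | P F]| + #|` [fset F in fpowerset D | P (x |` F)]|.
Proof.
move=> xD; have xF F : F `<=` D -> x \notin F by move/fsubsetP=> FD; apply: contra xD => /FD.
set S0 := [fset F in fpowerset D | P F]; set S1 := [fset F in fpowerset D | P (x |` F)].
have -> : [fset F in fpowerset (x |` D) | P F] = S0 `|` [fset x |` F | F in S1].
  apply/fsetP => F; rewrite !inE /= fpowersetE.
  apply/andP/orP => [[FxD PF]|[|/imfsetP[G]]].
  - have [xinF|xnF] := boolP (x \in F).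
      right; apply/imfsetP; exists (F `\ x); last by rewrite fsetD1K.
      by rewrite /= !inE /= fpowersetE fsubDset fsetD1K // FxD PF.
    left; rewrite fpowersetE PF andbT; apply/fsubsetP => y yF.
    move/fsubsetP: FxD => /(_ y yF); rewrite !inE => /orP[/eqP yx|//].
    by rewrite -yx yF in xnF.
  - by rewrite fpowersetE => /andP[FD ->]; rewrite (fsubset_trans FD) ?fsubsetUr.
  - by rewrite /= !inE /= fpowersetE => /andP[GD PG] ->; rewrite fsetUS.
rewrite cardfsU (_ : _ `&` _ = fset0) ?cardfs0 ?subn0; last first.
  apply/fsetP => F; rewrite !inE /= fpowersetE; apply/negP => /andP[/andP[/xF xnF _]].
  by case/imfsetP => G _ E; rewrite E fset1U1 in xnF.
congr (_ + _); apply: card_in_imfset => F G; rewrite /= !inE /= !fpowersetE.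
move=> /andP[/xF Fx _] /andP[/xF Gx _] E.
by rewrite -(fsetU1K Fx) E fsetU1K.
Qed.

Lemma card_fpowerset0 (K : choiceType) (P : pred {fset K}) :
  #|` [fset F in fpowerset (fset0 : {fset K}) | P F]| = P fset0.
Proof.
rewrite fpowerset0; case PF: (P fset0).
  rewrite (_ : [fset _ in _ | _] = [fset fset0]) ?cardfs1 //.
  by apply/fsetP=> F; rewrite !inE /=; case: eqP => // ->.
apply/eqP; rewrite cardfs_eq0; apply/eqP/fsetP=> F; rewrite !inE /=.
by case: eqP => // ->.
Qed.

Lemma eq_card_fpowerset (K : choiceType) (D : {fset K}) (P Q : pred {fset K}) :
  (forall F, F `<=` D -> P F = Q F) ->
  #|` [fset F in fpowerset D | P F]| = #|` [fset F in fpowerset D | Q F]|.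
Proof.
move=> PQ; congr #|` _|; apply/fsetP => F; rewrite !inE /= fpowersetE.
by case: (boolP (F `<=` D)) => //= /PQ.
Qed.

(** * Recursive shape of the rotation and its edge set *)

(* The irregular rotation for [n = 2] also fits, with [A = [:: -1; 2]] and
   [B = [:: 2; 1]]. *)
Lemma twisted_fib_rotation_rec n : 1 < n -> exists A B : seq int,
  [/\ twisted_fib_rotation n = A ++ B,
      twisted_fib_rotation n.+1 = A ++ Posz n.+1 :: B ++ [:: Posz n.+1]
    & twisted_fib_rotation n.+2 =
        A ++ Posz n.+1 :: B ++ [:: Posz n.+2; Posz n.+1; Posz n.+2]].
Proof.
case: n => [|[|[|d]]] // _.
  by exists [:: (-1)%Z; Posz 2], [:: Posz 2; Posz 1].
(* From three edges on, the word is cut just before its final letter: the next block [d.+4, d.+3]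
   places the new label in front of that letter. *)
exists ((-1)%Z :: map Posz ([:: 2; 3; 2; 1] ++
         flatten [seq [:: i; i.-1] | i <- iota 4 d])), [:: Posz d.+3].
have E k : twisted_fib_rotation (d + k).+3 = (-1)%Z :: map Posz ([:: 2; 3; 2; 1] ++
    flatten [seq [:: i; i.-1] | i <- iota 4 d] ++
    flatten [seq [:: i; i.-1] | i <- iota (4 + d) k] ++ [:: (d + k).+3]).
  rewrite /twisted_fib_rotation (_ : (d + k).+3 - 3 = d + k); last lia.
  by rewrite iotaD (map_cat _ (iota _ _)) flatten_cat -!catA.
split; first by rewrite -[in LHS](addn0 d) E addn0 /= map_cat.
  by rewrite -[in LHS](addn1 d) E /= map_cat addn1.
by rewrite -[in LHS](addn2 d) E /= map_cat addn2.
Qed.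

Lemma mem_twisted_fib_rotation n : 1 < n ->
  map absz (twisted_fib_rotation n) =i iota 1 n.
Proof.
elim: n => // n IH; rewrite leq_eqVlt => /orP[/eqP[<-] l|n1].
  by rewrite !inE; lia.
have [A [B [E1 -> _]]] := twisted_fib_rotation_rec n1.
move=> l; have := IH n1 l; rewrite E1 !map_cat /= map_cat !(mem_cat, inE) !mem_iota /=.
by case: (l \in map absz A); case: (l \in map absz B) => /=; lia.
Qed.

Lemma edges_twisted_fib n : 1 < n ->
  edges (twisted_fib_bouquet n) = [fset l in iota 1 n].
Proof.
by move=> n1; apply/fsetP => l; rewrite !inE /= mem_twisted_fib_rotation.
Qed.

Lemma fset_iotaS n : [fset l in iota 1 n.+1] = n.+1 |` [fset l in iota 1 n].
Proof. by apply/fsetP => l; rewrite !inE /= !mem_iota; lia. Qed.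

Lemma notin_fset_iota n k : n < k -> k \notin [fset l in iota 1 n].
Proof. by move=> nk; rewrite !inE /= mem_iota; lia. Qed.

(** * The recurrence for the number of quasi-trees *)

Lemma eq_quasi_tree (B C : bouquet) :
  rotation B = rotation C -> quasi_tree B = quasi_tree C.
Proof. by rewrite /quasi_tree /boundary_components => ->. Qed.

Lemma quasi_tree_iff (B C : bouquet) :
  (connected_boundary (rotation B) <-> connected_boundary (rotation C)) ->
  quasi_tree B = quasi_tree C.
Proof. by move=> BC; apply/idP/idP => /quasi_treeP/BC/quasi_treeP. Qed.

Lemma sub_rotation_fsetU1 (x : nat) (F : {fset nat}) (w : seq int) :
  x \notin map absz w -> sub_rotation (x |` F) w = sub_rotation F w.
Proof.
move=> xw; apply: eq_in_filter => y yw; rewrite !inE.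
by case: eqP => // E; rewrite -E map_f in xw.
Qed.

Lemma sub_rotation_absz (F : {fset nat}) (w : seq int) (x : nat) :
  x \notin map absz w -> x \notin map absz (sub_rotation F w).
Proof.
by apply: contra => /mapP[y]; rewrite mem_filter => /andP[_ yw] ->; apply: map_f.
Qed.

Lemma kappa_twisted_fib_rec n : 1 < n ->
  kappa (twisted_fib_bouquet n.+2) =
  kappa (twisted_fib_bouquet n.+1) + kappa (twisted_fib_bouquet n).
Proof.
move=> n1; rewrite /kappa !edges_twisted_fib ?(ltnW n1) //; last by lia.
rewrite fset_iotaS card_fpowersetU1 ?notin_fset_iota //.
have [A [B [E0 E1 E2]]] := twisted_fib_rotation_rec n1.
have wN k : n < k -> k \notin map absz (A ++ B).
  by rewrite -E0 mem_twisted_fib_rotation // mem_iota; lia.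
have := wN n.+1 (leqnn _); have := wN n.+2 (leqnSn _).
rewrite map_cat !mem_cat !negb_or => /andP[A2 B2] /andP[A1 B1].
congr (_ + _).
  (* Without [n.+2] the word [A, n+1, B, n+2, n+1, n+2] becomes [A, n+1, B, n+1], the rotation with
     [n.+1] edges. *)
  apply: eq_card_fpowerset => F /fsubsetP FD; apply: eq_quasi_tree => /=.
  have /negbTE F2 : n.+2 \notin F.
    by apply/negP => /FD; rewrite (negbTE (notin_fset_iota _)).
  by rewrite E1 E2 /sub_rotation !filter_cat /= !filter_cat /= F2.
rewrite fset_iotaS card_fpowersetU1 ?notin_fset_iota //.
(* With [n.+2] but without [n.+1], the two ends of [n.+2] become adjacent, so this case contributes
   nothing. *)
rewrite -[RHS]add0n; congr (_ + _).
  apply/eqP; rewrite cardfs_eq0; apply/eqP/fsetP => F; rewrite !inE /= fpowersetE.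
  apply/negP => /andP[/fsubsetP FD /quasi_treeP] /=.
  have /negbTE F1 : n.+1 \notin F.
    by apply/negP => /FD; rewrite (negbTE (notin_fset_iota _)).
  rewrite E2 /sub_rotation !filter_cat /= !filter_cat /= -!/(sub_rotation _ _).
  rewrite !sub_rotation_fsetU1 // !inE eqxx F1 /= eqn_leq ltnn andbF /= catA.
  apply: trivial_loop_disconnected => //=.
  by rewrite cats0 map_cat mem_cat negb_or !sub_rotation_absz.
(* With both edges present, the interlaced pair can be erased, which leaves the restriction of
   [A ++ B], the rotation with [n] edges. *)
apply: eq_card_fpowerset => F _; apply: quasi_tree_iff => /=.
rewrite E0 E2 /sub_rotation !filter_cat /= !filter_cat /= -!/(sub_rotation _ _).
rewrite !sub_rotation_fsetU1 // !inE !eqxx !orbT /=.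
by apply: interlaced_pair_reduction => /=; rewrite ?map_cat ?mem_cat ?negb_or
  ?sub_rotation_absz //; lia.
Qed.

(** * Base cases with two and three edges *)

Lemma connected_boundary_base (w : seq int) : (forall f, boundary_colouring w f ->
  forall i s, i < size w -> f i s = f 0 false) -> connected_boundary w.
Proof. by move=> cw f fw i j s t iw jw; rewrite (cw f) // (cw f fw j). Qed.

(** This is the boundary circle of a Möbius band: opposite signs glue first to first and last to
    last, and the four gluings form one cycle. *)
Lemma connected_boundary_1 :
  connected_boundary [:: (-1)%Z; Posz 1].
Proof.
apply: connected_boundary_base => f [arc wrap rib].
have r0t : f 0 true = f 1 true := rib 0 1 true isT isT isT erefl.
have r0f : f 0 false = f 1 false := rib 0 1 false isT isT isT erefl.
have := (arc 0 isT, wrap 1 erefl).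
by case=> [a0 a1] [|[|//]] [] _; congruence.
Qed.

(** An end of the twisted edge [1] lies between the ends of [3], so the boundary is traced gluing by
    gluing instead of by erasing an untwisted pair. *)
Lemma connected_boundary_13 :
  connected_boundary [:: (-1)%Z; Posz 3; Posz 1; Posz 3].
Proof.
apply: connected_boundary_base => f [arc wrap rib].
have r0t : f 0 true = f 2 true := rib 0 2 true isT isT isT erefl.
have r0f : f 0 false = f 2 false := rib 0 2 false isT isT isT erefl.
have r1t : f 1 true = f 3 false := rib 1 3 true isT isT isT erefl.
have r1f : f 1 false = f 3 true := rib 1 3 false isT isT isT erefl.
have := (arc 0 isT, arc 1 isT, arc 2 isT, wrap 3 erefl).
by case=> [[[a0 a1] a2] a3] [|[|[|[|//]]]] [] _; congruence.
Qed.

Lemma connected_boundary_123 :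
  connected_boundary [:: (-1)%Z; Posz 2; Posz 3; Posz 2; Posz 1; Posz 3].
Proof.
apply: connected_boundary_base => f [arc wrap rib].
have r0t : f 0 true = f 4 true := rib 0 4 true isT isT isT erefl.
have r0f : f 0 false = f 4 false := rib 0 4 false isT isT isT erefl.
have r1t : f 1 true = f 3 false := rib 1 3 true isT isT isT erefl.
have r1f : f 1 false = f 3 true := rib 1 3 false isT isT isT erefl.
have r2t : f 2 true = f 5 false := rib 2 5 true isT isT isT erefl.
have r2f : f 2 false = f 5 true := rib 2 5 false isT isT isT erefl.
have := (arc 0 isT, arc 1 isT, arc 2 isT, arc 3 isT, arc 4 isT, wrap 5 erefl).
by case=> [[[[[a0 a1] a2] a3] a4] a5] [|[|[|[|[|[|//]]]]]] [] _; congruence.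
Qed.

Lemma quasi_tree_spanning_true (B : bouquet) F w :
  sub_rotation F (rotation B) = w -> connected_boundary w ->
  quasi_tree (spanning_sub B F) = true.
Proof. by move=> <- ?; apply/quasi_treeP. Qed.

Lemma quasi_tree_spanning_false (B : bouquet) F w :
  sub_rotation F (rotation B) = w -> ~ connected_boundary w ->
  quasi_tree (spanning_sub B F) = false.
Proof. by move=> <- Nw; apply/negP => /quasi_treeP. Qed.

Lemma card_fpowerset_iota2 (P : pred {fset nat}) :
  #|` [fset F in fpowerset [fset l in iota 1 2] | P F]| =
  P fset0 + P [fset 1] + (P [fset 2] + P [fset 2; 1]).
Proof.
have i0 : [fset l in iota 1 0] = fset0 by apply/fsetP=> l; rewrite !inE.
rewrite fset_iotaS card_fpowersetU1 ?notin_fset_iota //.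
rewrite fset_iotaS !card_fpowersetU1 ?notin_fset_iota // i0 !card_fpowerset0.
by rewrite !fsetU0.
Qed.

(** The ends of the untwisted loop [2] are adjacent with or without edge [1], so only the empty set
    and the set of edge [1] count. *)
Lemma kappa_twisted_fib_2 : kappa (twisted_fib_bouquet 2) = 2.
Proof.
rewrite /kappa edges_twisted_fib // card_fpowerset_iota2.
rewrite (quasi_tree_spanning_true (w := [::])) //.
rewrite (quasi_tree_spanning_true (w := [:: (-1)%Z; Posz 1])); last first.
- exact: connected_boundary_1.
- by rewrite /sub_rotation /= ?inE.
rewrite (quasi_tree_spanning_false (w := [:: Posz 2; Posz 2])); last first.
- exact: (@trivial_loop_disconnected 2 2 [::] [::]).
- by rewrite /sub_rotation /= ?inE.
rewrite (quasi_tree_spanning_false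
  (w := [:: (-1)%Z; Posz 2; Posz 2; Posz 1])) //; last first.
- exact: (@trivial_loop_disconnected 2 2 [:: (-1)%Z] [:: Posz 1]).
- by rewrite /sub_rotation /= ?inE.
Qed.

Lemma kappa_twisted_fib_3 : kappa (twisted_fib_bouquet 3) = 5.
Proof.
rewrite /kappa edges_twisted_fib // fset_iotaS card_fpowersetU1 ?notin_fset_iota //.
(* Deleting edge [3] leaves the rotation with two edges, which gives 2. Of the four subsets
   containing [3], only the one with no other edge fails, which gives 3. *)
rewrite -[5]/(2 + 3); congr (_ + _).
  apply: etrans kappa_twisted_fib_2; rewrite /kappa edges_twisted_fib //.
  apply: eq_card_fpowerset => F /fsubsetP FD; apply: eq_quasi_tree => /=.
  have /negbTE F3 : 3 \notin F.
    by apply/negP => /FD; rewrite (negbTE (notin_fset_iota _)).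
  by rewrite /sub_rotation /= F3.
rewrite (card_fpowerset_iota2 (fun F => quasi_tree (spanning_sub _ (3 |` F)))).
rewrite (quasi_tree_spanning_false (w := [:: Posz 3; Posz 3])); last first.
- exact: (@trivial_loop_disconnected 3 3 [::] [::]).
- by rewrite /sub_rotation /= ?inE.
rewrite (quasi_tree_spanning_true (w := [:: (-1)%Z; Posz 3; Posz 1; Posz 3])); last first.
- exact: connected_boundary_13.
- by rewrite /sub_rotation /= ?inE.
rewrite (quasi_tree_spanning_true (w := [:: Posz 2; Posz 3; Posz 2; Posz 3])); last first.
(* Erasing the pair leaves the empty word, whose boundary is connected vacuously. *)
- by apply/(@interlaced_pair_reduction 2 3 [::] [::]).
- by rewrite /sub_rotation /= ?inE.
rewrite (quasi_tree_spanning_true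
  (w := [:: (-1)%Z; Posz 2; Posz 3; Posz 2; Posz 1; Posz 3])) //; last first.
- exact: connected_boundary_123.
- by rewrite /sub_rotation /= ?inE.
Qed.

Theorem theorem5p2 (n : nat) (hn : 2 <= n) :
  kappa (twisted_fib_bouquet n) = fibonacci n + lucas (n - 1).
Proof.
(* Two consecutive values are carried because the recurrence reaches back two steps. It starts from
   [2 = 1 + 1] and [5 = 2 + 3]. *)
have step k : kappa (twisted_fib_bouquet k.+2) = fibonacci k.+2 + lucas k.+1 /\
  kappa (twisted_fib_bouquet k.+3) = fibonacci k.+3 + lucas k.+2.
  elim: k => [|k [IH1 IH2]]; first by rewrite kappa_twisted_fib_2 kappa_twisted_fib_3.
  split=> //; rewrite kappa_twisted_fib_rec // IH1 IH2.
  rewrite -[fibonacci k.+4]/(fibonacci k.+3 + fibonacci k.+2).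
  by rewrite -[lucas k.+3]/(lucas k.+2 + lucas k.+1) addnACA.
by case: n hn => [|[|k]] // _; rewrite subn1; have [] := step k.
Qed.
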